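(* Consider the semi-Lagrangian discretization of an anisotropic time-optimal control problem with speed $f(x,a)$: $$U(x)=\min_{m\in\mathcal M(x)}\min_{\xi\in\Xi_n}\Big\{\frac{\tau^m(\xi)}{f(x,a^m_\xi)}+\sum_{i=1}^n\xi_iU(z^m_i)\Big\}\ \ (x\in X\cap\Omega),\qquad U(x)=q(x)\ \ (x\in X\cap\partial\Omega).$$ Suppose there exists $\delta\ge0$ such that for all $x\in X\cap\Omega$, $m\in\mathcal M(x)$, $\xi\in\Xi_n$ and $j\in\{1,\dots,n\}$, $$\xi_j>0\ \Longrightarrow\ \frac{\partial}{\partial\xi_j}\big[f(x,a^m_\xi)\big]<\frac{f(x,a^m_\xi)\Big[\frac{\partial\tau^m}{\partial\xi_j}(\xi)-\delta f(x,a^m_\xi)\Big]}{\tau^m(\xi)} .$$ Then the Dijkstra-like method is applicable, and if $\delta>0$ the Dial-like method with buckets of width $\delta$ is also applicable.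
   Context: $\Xi_n=\{\xi\in\mathbb R^n:\xi_1+\dots+\xi_n=1,\ \xi_j\ge0\}$. Setting. $\Omega\subset\mathbb R^n$ is a bounded domain and $X$ is the finite vertex set of a nondegenerate simplicial mesh on $\overline\Omega$. The speed $f(x,a)$, defined for $x\in\overline\Omega$ and unit vectors $a$, is Lipschitz-continuous, satisfies $0<F_1\le f\le F_2$, and is continuously differentiable in $a$; the boundary penalty $q:\partial\Omega\to[0,\infty)$ is Lipschitz-continuous. For each $x\in X\cap\Omega$ a computational stencil is given, i.e. a finite nonempty collection of nondegenerate $n$-simplexes with vertices in $X$ having $x$ as a vertex (for example, all mesh simplexes with vertex $x$); each gives one mode $m=(z^m_1,\dots,z^m_n)\in\mathcal M(x)$ consisting of its other $n$ vertices. For a nonzero $\xi$ with nonnegative entries, $\tau^m(\xi)=\big\|\sum_i\xi_i(z^m_i-x)\big\|$ (Euclidean norm) and $a^m_\xi=\big(\sum_i\xi_i(z^m_i-x)\big)/\tau^m(\xi)$; thus $\tau^m$ is homogeneous of degree one and $a^m_\xi$ of degree zero in $\xi$, and on $\Xi_n$ they are the distance and the unit direction from $x$ to $\sum_i\xi_iz^m_i$. Partial derivatives in $\xi_j$ are those of these homogeneous extensions. $U$ is the value function of the stochastic shortest path problem on $X\cup\{t\}$ with absorbing cost-free target $t$, $U(t)=0$: at $x\in X\cap\partial\Omega$ the only transition is deterministic to $t$ with cost $q(x)$; at $x\in X\cap\Omega$ one chooses $m\in\mathcal M(x)$ and $\xi\in\Xi_n$, pays $C^m(x,\xi)=\tau^m(\xi)/f(x,a^m_\xi)$,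 and moves to $z^m_j$ with probability $\xi_j$. $U(x)\in[0,+\infty]$ is the infimum over policies of the expected total cost accumulated from $x$; it satisfies the displayed system (with $0\cdot(+\infty)=0$). Label-setting methods. All nodes of $X$ start in the tentative list $L$, with the permanent list $P$ empty; the initial labels are $q(x)$ for $x\in X\cap\partial\Omega$ and $+\infty$ for $x\in X\cap\Omega$. Dijkstra-like method: repeatedly move a node $\bar x\in L$ with the smallest label to $P$, then replace the label of each $x\in L\cap\Omega$ by the minimum of its current value and $\inf\{C^m(x,\xi)+\sum_j\xi_jU(z^m_j)\}$ over all $m\in\mathcal M(x)$ and $\xi\in\Xi_n$ putting positive weight on $\bar x$ and zero weight on all nodes not in $P$ (using labels of nodes in $P$); stop when $L$ is empty or all remaining labels are $+\infty$. Dial-like method with buckets of width $\delta$: nodes of $L$ with finite labels are kept in buckets $[k\delta,(k+1)\delta)$, $k=0,1,\dots$; at each stage all nodes in the first nonempty bucket are simultaneously moved to $P$, then the labels of nodes $x\in L\cap\Omega$ are replaced by the minimum of the current label and $\inf\{C^m(x,\xi)+\sum_j\xi_jU(z^m_j)\}$ over $m\in\mathcal M(x)$ and $\xi\in\Xi_n$ with zero weight on all nodes not in $P$, the nodes are re-bucketed, and the method continues until $L$ is empty or all remaining labels are $+\infty$. A method is applicable if upon termination every label equals $U(x)$. *)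

(* Defs.v *)
From HB Require Import structures.
From mathcomp Require Import all_boot all_order all_algebra finmap.
From mathcomp Require Import all_classical all_reals all_analysis.
Import Order.TTheory GRing.Theory Num.Theory.
Import numFieldNormedType.Exports.

Set Implicit Arguments.
Unset Strict Implicit.
Unset Printing Implicit Defensive.

Local Open Scope classical_set_scope.
Local Open Scope ring_scope.

Section Geometry.
Context {R : realType} {n : nat}.

(* The library norm `|v| on 'rV[R]_n is the sup norm. *)
Definition enorm (v : 'rV[R]_n) : R := Num.sqrt (\sum_i v 0 i ^+ 2).

Definition unit_sphere : set 'rV[R]_n := [set a | enorm a = 1].

Definition bounded_domain (Omega : set 'rV[R]_n) : Prop :=
  [/\ open Omega, connected Omega, Omega !=set0 & bounded_set Omega].

Definition boundary (A : set 'rV[R]_n) : set 'rV[R]_n := closure A `\` A°.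

(* The set Xi_n of probability vectors. *)
Definition prob_simplex : set 'rV[R]_n :=
  [set xi | (forall j, 0 <= xi 0 j) /\ \sum_j xi 0 j = 1].

Definition supported_on (X : {fset 'rV[R]_n}) (S : {set X}) (w : X -> R) : Prop :=
  forall v, v \notin S -> w v = 0.

Definition convex_hull (X : {fset 'rV[R]_n}) (S : {set X}) : set 'rV[R]_n :=
  [set p | exists w : X -> R,
    [/\ forall v, 0 <= w v, supported_on S w, \sum_v w v = 1
      & p = \sum_v w v *: val v]].

(* The vertex set of a nondegenerate n-simplex: n + 1 affinely independent
   points. *)
Definition nondegenerate_simplex (X : {fset 'rV[R]_n}) (S : {set X}) : Prop :=
  #|S| = n.+1 /\
  forall w : X -> R, supported_on S w ->
    \sum_v w v = 0 -> \sum_v w v *: val v = 0 -> forall v, w v = 0.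

(* X is exactly the vertex set of the face-to-face triangulation T of D. *)
Definition simplicial_mesh (D : set 'rV[R]_n) (X : {fset 'rV[R]_n})
    (T : {set {set X}}) : Prop :=
  [/\ forall S, S \in T -> nondegenerate_simplex S,
      forall S S', S \in T -> S' \in T ->
        convex_hull S `&` convex_hull S' = convex_hull (S :&: S')%SET,
      forall x : X, exists2 S, S \in T & x \in S
    & [set p | exists2 S, S \in T & convex_hull S p] = D].

(* Continuous differentiability of g on the unit sphere, expressed through the
   extension of g to nonzero vectors that is homogeneous of degree zero. *)
Definition C1_on_sphere (g : 'rV[R]_n -> R) : Prop :=
  let g0 := fun v => g ((enorm v)^-1 *: v) in
  forall v, v != 0 ->
    differentiable g0 v /\
    forall h, {for v, continuous (fun w => 'D_h g0 w)}.

Definition speed_function (Omega : set 'rV[R]_n) (f : 'rV[R]_n -> 'rV[R]_n -> R)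
    : Prop :=
  [/\ [lipschitz f u.1 u.2 | u in closure Omega `*` unit_sphere],
      exists F1 F2 : R, 0 < F1 /\
        forall x a, closure Omega x -> unit_sphere a -> F1 <= f x a <= F2
    & forall x, closure Omega x -> C1_on_sphere (f x)].

Definition boundary_penalty (Omega : set 'rV[R]_n) (q : 'rV[R]_n -> R) : Prop :=
  (forall x, boundary Omega x -> 0 <= q x) /\
  [lipschitz q x | x in boundary Omega].

(* A mode lists the vertices z_1, ..., z_n of a stencil simplex other than x. *)
Definition stencils (Omega : set 'rV[R]_n) (X : {fset 'rV[R]_n})
    (M : X -> {set {ffun 'I_n -> X}}) : Prop :=
  forall x : X, Omega (val x) ->
    (exists m, m \in M x) /\
    forall m, m \in M x ->
      nondegenerate_simplex (x |: [set m j | j : 'I_n])%SET.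

Definition displacement (X : {fset 'rV[R]_n}) (x : X) (m : {ffun 'I_n -> X})
    (xi : 'rV[R]_n) : 'rV[R]_n :=
  \sum_i xi 0 i *: (val (m i) - val x).

Definition tau (X : {fset 'rV[R]_n}) (x : X) (m : {ffun 'I_n -> X})
    (xi : 'rV[R]_n) : R :=
  enorm (displacement x m xi).

Definition direction (X : {fset 'rV[R]_n}) (x : X) (m : {ffun 'I_n -> X})
    (xi : 'rV[R]_n) : 'rV[R]_n :=
  (tau x m xi)^-1 *: displacement x m xi.

End Geometry.

Section StochasticShortestPath.
Context {R : realType} {n : nat}.
Variables (Omega : set 'rV[R]_n) (f : 'rV[R]_n -> 'rV[R]_n -> R)
  (q : 'rV[R]_n -> R) (X : {fset 'rV[R]_n}) (M : X -> {set {ffun 'I_n -> X}}).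

(* In this section X is a subset of closure Omega with Omega open, so the nodes
   outside Omega are the nodes on the boundary. *)

Definition control : Type := ({ffun 'I_n -> X} * 'rV[R]_n)%type.

Definition admissible (x : X) : set control :=
  [set u | u.1 \in M x /\ prob_simplex u.2].

Definition run_cost (x : X) (u : control) : R :=
  tau x u.1 u.2 / f (val x) (direction x u.1 u.2).

(* States of the controlled chain are the nodes [Some x] and the target [None];
   a control law is only used at the nodes in Omega. *)

Definition transition (mu : X -> control) (s s' : option X) : R :=
  if s is Some x then
    if val x \in Omega then
      if s' is Some y then \sum_(j | (mu x).1 j == y) (mu x).2 0 j else 0
    else (s' == None)%:R
  else (s' == None)%:R.

Definition stage_cost (mu : X -> control) (s : option X) : R :=
  if s is Some x then
    if val x \in Omega then run_cost x (mu x) else q (val x)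
  else 0.

Definition policy : Type := nat -> X -> control.

Definition admissible_policy : set policy :=
  [set pi | forall k x, Omega (val x) -> admissible x (pi k x)].

(* Distribution of the state after k transitions from x. *)
Fixpoint state_dist (pi : policy) (x : X) (k : nat) (s : option X) : R :=
  if k is k'.+1 then \sum_r state_dist pi x k' r * transition (pi k') r s
  else (s == Some x)%:R.

Definition expected_cost (pi : policy) (x : X) : \bar R :=
  (\sum_(0 <= k <oo) (\sum_s state_dist pi x k s * stage_cost (pi k) s)%:E)%E.

Definition value (x : X) : \bar R :=
  ereal_inf [set expected_cost pi x | pi in admissible_policy].

(* The tentative list is the complement of [permanent]. *)
Record state := State { permanent : {set X}; label : X -> \bar R }.

Definition initial_state : state :=
  State finset.set0
    (fun x => if val x \in Omega then +oo%E else (q (val x))%:E).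

Definition stopped (s : state) : Prop :=
  forall x, x \notin permanent s -> label s x = +oo%E.

Definition one_step_cost (lab : X -> \bar R) (x : X) (u : control) : \bar R :=
  ((run_cost x u)%:E + \sum_j (u.2 0 j)%:E * lab (u.1 j))%E.

Definition zero_weight_outside (P : {set X}) : set control :=
  [set u : control | forall j, u.1 j \notin P -> u.2 0 j = 0].

Definition positive_weight_on (y : X) : set control :=
  [set u : control | exists2 j, u.1 j = y & 0 < u.2 0 j].

(* New labels, once P is the permanent list, from controls in A. *)
Definition relabel (P : {set X}) (A : set control) (lab : X -> \bar R)
    (x : X) : \bar R :=
  if (x \notin P) && (val x \in Omega) then
    Order.min (lab x)
      (ereal_inf [set one_step_cost lab x u | u in admissible x `&` A])
  else lab x.

Definition dijkstra_step (s s' : state) : Prop :=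
  exists y : X,
    [/\ y \notin permanent s,
        forall x, x \notin permanent s -> (label s y <= label s x)%E
      & let P := (y |: permanent s)%SET in
        s' = State P
          (relabel P (positive_weight_on y `&` zero_weight_outside P) (label s))].

Definition bucket (delta : R) (s : state) (k : nat) : {set X} :=
  [set x | (x \notin permanent s) &&
           ((k%:R * delta)%:E <= label s x < (k.+1%:R * delta)%:E)%E]%SET.

Definition dial_step (delta : R) (s s' : state) : Prop :=
  exists k : nat,
    [/\ bucket delta s k <> finset.set0,
        forall i, (i < k)%N -> bucket delta s i = finset.set0
      & let P := (permanent s :|: bucket delta s k)%SET in
        s' = State P (relabel P (zero_weight_outside P) (label s))].

(* Every execution from s (whatever choices are made by step) reaches, without
   getting stuck and after finitely many stages, the stopping condition, and
   the final labels then satisfy Q. *)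
Inductive terminates_with (step : state -> state -> Prop)
    (Q : (X -> \bar R) -> Prop) (s : state) : Prop :=
| TerminatesNow of stopped s & Q (label s)
| TerminatesLater of ~ stopped s & (exists s', step s s') &
    (forall s', step s s' -> terminates_with step Q s').

Definition applicable (step : state -> state -> Prop) : Prop :=
  terminates_with step (fun lab => forall x, lab x = value x) initial_state.

End StochasticShortestPath.

(* Main.v *)
Require Import Defs.
From HB Require Import structures.
From mathcomp Require Import all_boot all_order all_algebra finmap.
From mathcomp Require Import all_classical all_reals all_analysis.
From mathcomp Require Import ring lra.
Import Order.TTheory GRing.Theory Num.Theory.
Import numFieldNormedType.Exports.

Set Implicit Arguments.
Unset Strict Implicit.
Unset Printing Implicit Defensive.

Local Open Scope classical_set_scope.
Local Open Scope ring_scope.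

(* At an optimal control xi, moving xi along a coordinate axis and rescaling by
   homogeneity shows that, for every j with xi_j > 0,
     U(x) = dC/dxi_j + U(z_j).
   The hypothesis on f says exactly that dC/dxi_j > delta, so an optimal control
   only uses nodes with labels less than U(x) - delta. Hence when nodes are
   accepted by increasing labels (or by buckets of width delta), an optimal
   control relative to the accepted nodes is always available at the time a node
   is accepted, and the labels solve the Bellman system. A fixed point of that
   system is the value function: the minimizing controls give a stationary
   policy for which the labels are a nonnegative supersolution, and along any
   policy of finite cost the labels are a subsolution whose mean tends to 0,
   because every step taken in Omega costs at least a positive constant. *)

(** * Minimization over the probability simplex *)

Section EuclideanNorm.
Context {R : realType} {n : nat}.
Implicit Types v : 'rV[R]_n.

Lemma enormZ (t : R) v : enorm (t *: v) = `|t| * enorm v.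
Proof.
rewrite /enorm -sqrtr_sqr -sqrtrM ?sqr_ge0// mulr_sumr.
by congr Num.sqrt; apply: eq_bigr => i _; rewrite mxE exprMn.
Qed.

Lemma sum_sqr_gt0 v : v != 0 -> 0 < \sum_i v 0 i ^+ 2.
Proof.
move=> v0; rewrite lt0r sumr_ge0 ?andbT => [|i _]; last exact: sqr_ge0.
apply: contra_neq v0 => /eqP; rewrite psumr_eq0 => [/allP v2|i _]; last first.
  exact: sqr_ge0.
apply/rowP => i; rewrite mxE; apply/eqP.
by rewrite -sqrf_eq0; apply: v2; rewrite mem_index_enum.
Qed.

Lemma enorm_gt0 v : v != 0 -> 0 < enorm v.
Proof. by move=> v0; rewrite sqrtr_gt0 sum_sqr_gt0. Qed.

Lemma enorm_normalize v : v != 0 -> enorm ((enorm v)^-1 *: v) = 1.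
Proof.
move=> /enorm_gt0 v0; rewrite enormZ gtr0_norm ?invr_gt0//.
by rewrite mulVf// gt_eqF.
Qed.

Lemma differentiable_enorm v : v != 0 -> differentiable (@enorm R n) v.
Proof.
move=> v0.
have -> : @enorm R n =
    Num.sqrt \o (\sum_(i < n) (fun w : 'rV[R]_n => w 0 i) ^+ 2).
  apply/funext => w; rewrite /enorm /= fct_sumE; congr Num.sqrt.
apply: differentiable_comp.
  apply: differentiable_sum => i; apply: differentiableX.
  exact: differentiable_coord.
apply/derivable1_diffP.
have s0 : 0 < (\sum_(i < n) (fun w : 'rV[R]_n => w 0 i) ^+ 2 : 'rV[R]_n -> R) v.
  by rewrite fct_sumE; exact: sum_sqr_gt0.
exact: (@ex_derive _ _ _ _ _ _ _ (is_derive1_sqrt s0)).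
Qed.

End EuclideanNorm.

Section ProbSimplex.
Context {R : realType} {n : nat}.
Implicit Types xi eta : 'rV[R]_n.

(** A face is bounded, its coordinates being nonnegative with sum 1, and it is cut out by closed
    conditions on continuous coordinates. Faces occur because controls are restricted to accepted
    nodes. *)
Lemma compact_prob_face (J : pred 'I_n) :
  compact [set xi | @prob_simplex R n xi /\ forall j, ~~ J j -> xi 0 j = 0].
Proof.
apply: bounded_closed_compact.
  exists 1; split => // M M1 xi [[xi0 xi1] _].
  rewrite /= [leLHS]/Num.norm /= mx_normrE; apply/bigmax_leP; split.
    by rewrite (le_trans _ (ltW M1)).
  move=> [i j] _ /=; rewrite (ord1 i) ger0_norm//.
  rewrite (le_trans _ (ltW M1))// -xi1 (bigD1 j)//= lerDl.
  by apply: sumr_ge0 => k _; exact: xi0.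
have cc (j : 'I_n) : continuous (fun xi : 'rV[R]_n => xi 0 j).
  by move=> xi; apply: differentiable_continuous; exact: differentiable_coord.
have -> : [set xi | @prob_simplex R n xi /\ forall j, ~~ J j -> xi 0 j = 0] =
   (\bigcap_(j in setT) ((fun xi : 'rV[R]_n => xi 0 j) @^-1` [set x | 0 <= x])) `&`
   ((\sum_(j < n) (fun xi : 'rV[R]_n => xi 0 j)) @^-1` [set x | x = 1]) `&`
   (\bigcap_(j in [set j | ~~ J j])
      ((fun xi : 'rV[R]_n => xi 0 j) @^-1` [set x | x = 0])).
  apply/seteqP; split => xi /=.
    move=> [[xi0 xi1] xiJ]; split; last by move=> j /=; exact: xiJ.
    by split; [move=> j _ /=|rewrite fct_sumE].
  move=> [[xi0 xi1] xiJ]; split; last by move=> j /=; exact: xiJ.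
  by split; [move=> j; exact: (xi0 j)|rewrite fct_sumE in xi1].
apply: closedI; first apply: closedI.
- apply: closed_bigI => j _; apply: preimage_closed; last exact: closed_ge.
  by move=> xi _; exact: cc.
- apply: preimage_closed; last exact: closed_eq.
  move=> xi _.
  apply: differentiable_continuous; apply: differentiable_sum => j.
  exact: differentiable_coord.
- apply: closed_bigI => j _; apply: preimage_closed; last exact: closed_eq.
  by move=> xi _; exact: cc.
Qed.

Lemma prob_simplex_delta (j : 'I_n) : prob_simplex (delta_mx 0 j : 'rV[R]_n).
Proof.
split=> [k|]; first by rewrite mxE; case: (_ && _).
rewrite (bigD1 j)//= mxE !eqxx/= big1 ?addr0// => k kj.
by rewrite mxE (negbTE kj) andbF.
Qed.

Lemma prob_face_min (G : 'rV[R]_n -> R) (J : pred 'I_n) (j0 : 'I_n) : J j0 ->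
  (forall xi, prob_simplex xi -> differentiable G xi) ->
  exists xi, [/\ prob_simplex xi, forall j, ~~ J j -> xi 0 j = 0 &
    forall eta, prob_simplex eta -> (forall j, ~~ J j -> eta 0 j = 0) ->
      G xi <= G eta].
Proof.
move=> Jj0 dG.
set A := [set xi | @prob_simplex R n xi /\ forall j, ~~ J j -> xi 0 j = 0].
have [||xi] := EVT_min_rV (f := G) _ (@compact_prob_face J).
- exists (delta_mx 0 j0); split; first exact: prob_simplex_delta.
  by move=> j; rewrite mxE /=; case: eqVneq => [->|]; rewrite ?Jj0 ?andbF.
- apply: continuous_in_subspaceT => xi; rewrite inE => -[xiP _].
  by apply: differentiable_continuous; exact: dG.
rewrite inE => -[xiP xiJ] xi_min; exists xi; split => // eta etaP etaJ.
by apply: xi_min; rewrite inE.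
Qed.

(* By homogeneity [G (xi + t e_j) - (1 + t) G xi >= 0] for all small [t] of
   either sign, with equality at [t = 0]; the derivative at [0] vanishes. *)
Lemma homogeneous_min_derive (G : 'rV[R]_n -> R) xi (j : 'I_n) :
  (forall (t : R) eta, 0 < t -> G (t *: eta) = t * G eta) ->
  (forall eta : 'rV[R]_n, (forall i, 0 <= eta 0 i) -> 0 < \sum_i eta 0 i ->
     differentiable G eta) ->
  prob_simplex xi -> 0 < xi 0 j ->
  (forall eta, prob_simplex eta -> (forall i, xi 0 i = 0 -> eta 0 i = 0) ->
     G xi <= G eta) ->
  'D_(delta_mx 0 j) G xi = G xi.
Proof.
move=> homG dG [xi0 xi1] xij xi_min.
pose e : 'rV[R]_n := delta_mx 0 j.
have sum_e (t : R) : \sum_i (t *: e + xi) 0 i = 1 + t.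
  under eq_bigr do rewrite !mxE /=.
  rewrite big_split /= xi1 addrC; congr (_ + _).
  rewrite (bigD1 j)//= eqxx mulr1 big1 ?addr0// => k /negbTE ->.
  by rewrite mulr0.
have pos_e (t : R) : - xi 0 j < t -> forall i, 0 <= (t *: e + xi) 0 i.
  move=> tj i; rewrite !mxE /=; case: eqVneq => [->|_] /=.
    by rewrite mulr1; lra.
  by rewrite mulr0 add0r.
(* Hence [t > - xi 0 j] forces [1 + t > 0], so [t *: e + xi] can be rescaled into the simplex. *)
have xij1 : xi 0 j <= 1.
  by rewrite -xi1 (bigD1 j)//= lerDl; apply: sumr_ge0 => k _.
have dGt (t : R) : - xi 0 j < t -> derivable G (t *: e + xi) e.
  move=> tj; apply: diff_derivable; apply: dG; first exact: pos_e.
  by rewrite sum_e; lra.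
pose h (t : R) := G (t *: e + xi) - (1 + t) * G xi.
have dh (t : R) : - xi 0 j < t -> is_derive t 1 h ('D_e G (t *: e + xi) - G xi).
  move=> tj.
  have d1 : is_derive t 1 (fun s : R => G (s *: e + xi)) ('D_e G (t *: e + xi)).
    have eqf : (fun s : R => s^-1 *:
          (((fun s : R => G (s *: e + xi)) \o shift t) (s *: 1)
           - G (t *: e + xi))) =
        (fun s : R => s^-1 *:
          ((G \o shift (t *: e + xi)) (s *: e) - G (t *: e + xi))).
      apply/funext => s /=; congr (_ *: (G _ - _)).
      by rewrite [s%:A]mulr1 scalerDl addrA.
    split; last by rewrite /derive eqf.
    by have := dGt _ tj; rewrite /derivable eqf.
  have d2 : is_derive t 1 ((cst 1 + id) * cst (G xi) : R -> R) (G xi).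
    by apply: is_derive_eq; rewrite add0r scaler0 add0r [LHS]mulr1.
  exact: is_deriveB.
have h0 : h 0 = 0 by rewrite /h scale0r add0r addr0 mul1r subrr.
have hmin (t : R) : t \in `](- xi 0 j), (xi 0 j)[%R -> h 0 <= h t.
  rewrite in_itv /= => /andP[t1 t2]; rewrite h0 /h subr_ge0.
  have t0 : 0 < 1 + t by lra.
  (* Dividing by [1 + t] brings the perturbed point back to coordinate sum 1; homogeneity turns the
     claim into minimality of [xi] there. *)
  rewrite -(@ler_pM2l _ (1 + t)^-1) ?invr_gt0// mulKf ?gt_eqF//.
  rewrite -homG ?invr_gt0//; apply: xi_min.
    split=> [i|].
      by rewrite mxE mulr_ge0 ?invr_ge0 ?(ltW t0)//; exact: pos_e.
    under eq_bigr do rewrite mxE.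
    by rewrite -mulr_sumr sum_e mulVf// gt_eqF.
  (* Since [xi 0 j > 0], the perturbation along [e] creates no new support. *)
  move=> i xii; rewrite !mxE xii addr0 /=; case: eqVneq => [ij|_] /=.
    by move: xij; rewrite -ij xii ltxx.
  by rewrite !mulr0.
have h'0 : is_derive (0 : R) 1 h 0.
  apply: (@derive1_at_min R h (- xi 0 j) (xi 0 j) 0).
  - lra.
  - move=> t; rewrite in_itv /= => /andP[t1 _].
    exact: (@ex_derive _ _ _ _ _ _ _ (dh _ t1)).
  - by rewrite in_itv /=; lra.
  - exact: hmin.
have dh0 : is_derive (0 : R) 1 h ('D_e G xi - G xi).
  by rewrite -[xi in 'D_e G xi]add0r -(scale0r e); apply: dh; lra.
apply/eqP; rewrite -subr_eq0; apply/eqP.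
by rewrite -(@derive_val _ _ _ _ _ _ _ dh0) (@derive_val _ _ _ _ _ _ _ h'0).
Qed.

End ProbSimplex.

(** * Running cost and causality *)

Section Displacement.
Context {R : realType} {n : nat} {X : {fset 'rV[R]_n}}.
Implicit Types (x : X) (m : {ffun 'I_n -> X}) (xi : 'rV[R]_n).

Lemma displacementZ x m (t : R) xi :
  displacement x m (t *: xi) = t *: displacement x m xi.
Proof.
rewrite /displacement scaler_sumr; apply: eq_bigr => i _.
by rewrite mxE scalerA.
Qed.

Lemma differentiable_displacement x m xi :
  differentiable (displacement x m) xi.
Proof.
have -> : displacement x m =
    \sum_i (fun xi : 'rV[R]_n => xi 0 i *: (val (m i) - val x)).
  by apply/funext => eta; rewrite fct_sumE.
apply: differentiable_sum => i; apply: differentiableZl.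
exact: differentiable_coord.
Qed.

(** A zero displacement would be an affine dependence of the simplex vertices, with weights [xi 0 j]
    on [m j] and -1 on [x]. *)
Lemma displacement_neq0 x m xi :
  nondegenerate_simplex (x |: [set m j | j : 'I_n])%SET ->
  prob_simplex xi -> displacement x m xi != 0.
Proof.
move=> [cardS indep] [_ xi1].
(* If [x] were some [m j], the vertex set would have at most n elements instead of n + 1. *)
have xm j : m j != x.
  apply/eqP => mjx; have : (#|x |: [set m j | j : 'I_n]| <= n)%N.
    rewrite (_ : x |: _ = [set m j | j : 'I_n])%SET; last first.
      by apply/finset.setUidPr; rewrite finset.sub1set -mjx imset_f.
    by rewrite (leq_trans (leq_imset_card _ _))// card_ord.
  by rewrite cardS ltnn.
apply/eqP => d0.
pose w (v : X) : R := \sum_(j | m j == v) xi 0 j - (v == x)%:R.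
have wx : w x = -1.
  by rewrite /w eqxx big1 ?sub0r// => j mjx; rewrite (negbTE (xm j)) in mjx.
(* Stated for any module so that it serves twice: a constant [g] gives total weight 0, and [val]
   gives the displacement. *)
have sum_w (V : lmodType R) (g : X -> V) :
    \sum_v w v *: g v = \sum_j xi 0 j *: (g (m j) - g x).
  under eq_bigr do rewrite /w scalerBl scaler_suml.
  rewrite big_split /= sumrN [X in _ - X](bigD1 x)//= eqxx scale1r.
  rewrite [X in _ - (_ + X)]big1 => [|v /negbTE ->]; last by rewrite scale0r.
  under [in RHS]eq_bigr do rewrite scalerBr.
  rewrite big_split /= sumrN -scaler_suml xi1 scale1r addr0; congr (_ - _).
  rewrite (exchange_big_dep predT)//=; apply: eq_bigr => j _.
  by rewrite (big_pred1 (m j))// => v /=; rewrite eq_sym.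
suff : w x = 0 by rewrite wx => /eqP; rewrite oppr_eq0 oner_eq0.
apply: indep.
- move=> v; rewrite !inE negb_or => /andP[/negbTE vx vm].
  rewrite /w vx subr0 big1// => j /eqP mjv.
  by rewrite -mjv imset_f in vm.
- have := sum_w R^o (fun=> 1); under eq_bigr do rewrite [_ *: _]mulr1.
  by move=> ->; rewrite big1// => j _; rewrite subrr scaler0.
- by rewrite sum_w.
Qed.

End Displacement.

Definition causal (R : realType) (n : nat) (Omega : set 'rV[R]_n)
    (f : 'rV[R]_n -> 'rV[R]_n -> R) (X : {fset 'rV[R]_n})
    (M : X -> {set {ffun 'I_n -> X}}) (delta : R) : Prop :=
  forall (x : X) (m : {ffun 'I_n -> X}) (xi : 'rV[R]_n) (j : 'I_n),
    Omega (val x) -> m \in M x -> prob_simplex xi -> 0 < xi 0 j ->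
    'D_(delta_mx 0 j) (fun eta => f (val x) (direction x m eta)) xi <
    f (val x) (direction x m xi) *
      ('D_(delta_mx 0 j) (tau x m) xi
         - delta * f (val x) (direction x m xi)) / tau x m xi.

Section CausalCost.
Context {R : realType} {n : nat} (Omega : set 'rV[R]_n)
  (f : 'rV[R]_n -> 'rV[R]_n -> R) (X : {fset 'rV[R]_n})
  (M : X -> {set {ffun 'I_n -> X}}) (delta : R).
Hypothesis hf : speed_function Omega f.
Hypothesis hM : stencils Omega M.
Hypothesis hcausal : causal Omega f M delta.

Implicit Types (x : X) (m : {ffun 'I_n -> X}) (xi eta : 'rV[R]_n).

Lemma speed_gt0 x m eta :
  Omega (val x) -> displacement x m eta != 0 ->
  0 < f (val x) (direction x m eta).
Proof.
move=> Ox d0; have [_ [F1 [F2 [F10 F1f]]] _] := hf.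
rewrite (lt_le_trans F10)//.
have /andP[//] : F1 <= f (val x) (direction x m eta) <= F2.
by apply: F1f; [exact: subset_closure|exact: enorm_normalize].
Qed.

Lemma run_costZ x m (t : R) eta : 0 < t ->
  run_cost f x (m, t *: eta) = t * run_cost f x (m, eta).
Proof.
move=> t0; rewrite /run_cost /= /direction /tau displacementZ enormZ gtr0_norm//.
(* When the displacement vanishes both costs are 0, so homogeneity holds for every [eta]. *)
have [d0|d0] := eqVneq (enorm (displacement x m eta)) 0.
  by rewrite d0 !(mulr0, mul0r).
by rewrite scalerA invfM [t^-1 / _ * t]mulrAC mulVf ?gt_eqF// mul1r mulrA.
Qed.

Lemma differentiable_tau x m eta : displacement x m eta != 0 ->
  differentiable (tau x m) eta.
Proof.
move=> d0; apply: (differentiable_comp (f := displacement x m)).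
  exact: differentiable_displacement.
exact: differentiable_enorm.
Qed.

Lemma differentiable_speed x m eta : Omega (val x) ->
  displacement x m eta != 0 ->
  differentiable (fun eta => f (val x) (direction x m eta)) eta.
Proof.
move=> Ox d0; have [_ _ C1f] := hf.
apply: (differentiable_comp (f := displacement x m)
  (g := fun v => f (val x) ((enorm v)^-1 *: v))).
  exact: differentiable_displacement.
by have [] := C1f (val x) (subset_closure Ox) _ d0.
Qed.

Lemma differentiable_run_cost x m eta : Omega (val x) ->
  displacement x m eta != 0 ->
  differentiable (fun eta => run_cost f x (m, eta)) eta.
Proof.
move=> Ox d0; apply: differentiableM; first exact: differentiable_tau.
apply: differentiableV; first exact: differentiable_speed.
by rewrite gt_eqF// speed_gt0.
Qed.

Lemma run_cost_gt0 x m eta : Omega (val x) -> displacement x m eta != 0 ->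
  0 < run_cost f x (m, eta).
Proof. by move=> Ox d0; rewrite divr_gt0 ?speed_gt0// enorm_gt0. Qed.

(** This is the causality hypothesis after the quotient rule for [tau / f]: the difference of the
    two sides is the difference in the hypothesis divided by a positive factor. *)
Lemma run_cost_derive_gt x m xi (j : 'I_n) :
  Omega (val x) -> m \in M x -> prob_simplex xi -> 0 < xi 0 j ->
  delta < 'D_(delta_mx 0 j) (fun eta => run_cost f x (m, eta)) xi.
Proof.
move=> Ox mx xiP xij; have := hcausal Ox mx xiP xij.
have d0 : displacement x m xi != 0.
  by apply: displacement_neq0 => //; exact: (hM Ox).2.
have dtau := diff_derivable (v := delta_mx 0 j) (differentiable_tau d0).
have dspeed := diff_derivable (v := delta_mx 0 j) (differentiable_speed Ox d0).
have f0 := speed_gt0 Ox d0.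
have t0 : 0 < tau x m xi by exact: enorm_gt0.
rewrite (deriveM dtau (derivableV _ dspeed)) ?gt_eqF// deriveV ?gt_eqF//.
move: f0 t0 ('D_('e_j) _ xi : R) ('D_('e_j) _ xi : R).
set F := f _ _; set t := tau _ _ _ => F0 t0 t' f'.
rewrite ltr_pdivlMr// => H.
rewrite /GRing.scale /= -subr_gt0.
have -> : t * (- F ^- 2 * f') + F^-1 * t' - delta =
   (F * (t' - delta * F) - f' * t) / F ^+ 2 by field; rewrite gt_eqF.
by rewrite divr_gt0 ?exprn_gt0// subr_gt0.
Qed.

Lemma derive_weighted_sum (c : 'I_n -> R) xi (j : 'I_n) :
  is_derive xi (delta_mx 0 j)
    (fun eta : 'rV[R]_n => \sum_i eta 0 i * c i) (c j).
Proof.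
pose L eta : R := \sum_i eta 0 i * c i.
suff cL : (fun h : R => h^-1 *:
    ((L \o shift xi) (h *: delta_mx 0 j) - L xi)) @ 0^' --> c j.
  by split; [apply/cvg_ex; exists (c j)|exact: cvg_lim cL].
(* By linearity the difference quotient equals [c j] for every nonzero [h]. *)
apply: cvg_near_cst; near=> h.
have h0 : h != 0 by near: h; exact: nbhs_dnbhs_neq.
rewrite /L /= -sumrB (bigD1 j)//= big1 => [|i ij].
  by rewrite !mxE !eqxx /= mulr1 mulrDl addrK addr0 /GRing.scale /= mulKf.
by rewrite !mxE (negbTE ij) andbF mulr0 add0r subrr.
Unshelve. all: by end_near. Qed.

(** Real-valued counterpart of [one_step_cost], on which calculus is possible; the two agree for
    controls supported on nodes with finite labels. *)
Definition real_cost (w : X -> R) x (u : control X) : R :=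
  run_cost f x u + \sum_j u.2 0 j * w (u.1 j).

(** Compactness gives a minimizer on the face of each mode, and there are finitely many modes. At
    the minimizer the cost equals its own partial derivative, which is [w (u.1 j)] plus a term
    exceeding [delta]. The control [u0] serves to show that some face is nonempty. *)
Lemma optimal_control (w : X -> R) x (P : {set X}) u0 :
  Omega (val x) -> admissible M x u0 -> zero_weight_outside P u0 ->
  exists u, [/\ admissible M x u, zero_weight_outside P u,
    forall v, admissible M x v -> zero_weight_outside P v ->
      real_cost w x u <= real_cost w x v &
    forall j, 0 < u.2 0 j -> w (u.1 j) + delta < real_cost w x u].
Proof.
move=> Ox.
(* The modes with a vertex in [P] are exactly those carrying a control supported on [P]. *)
pose Q m := (m \in M x) && [exists j, m j \in P].
have adQ u : admissible M x u -> zero_weight_outside P u -> Q u.1.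
  move=> [uM [_ u1]] uP; rewrite /Q uM; apply/existsP/not_existsP => noP.
  have /eqP := u1; rewrite big1 => [|j _]; first by rewrite eq_sym oner_eq0.
  by apply: uP; apply/negP; exact: noP.
have nd m eta : m \in M x -> prob_simplex eta -> displacement x m eta != 0.
  by move=> mx; apply: displacement_neq0; exact: (hM Ox).2.
have dG m eta : displacement x m eta != 0 ->
    differentiable (fun eta => real_cost w x (m, eta)) eta.
  move=> d0; apply: differentiableD; first exact: differentiable_run_cost.
  rewrite (_ : (fun _ => _) =
      \sum_j (fun eta : 'rV[R]_n => eta 0 j *: (w (m j) : R^o))).
    apply: differentiable_sum => j; apply: differentiableZl.
    exact: differentiable_coord.
  by apply/funext => ?; rewrite fct_sumE.
have /choice[g gP] m : exists xi, Q m -> [/\ prob_simplex xi,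
    forall j, m j \notin P -> xi 0 j = 0 &
    forall eta, prob_simplex eta -> (forall j, m j \notin P -> eta 0 j = 0) ->
      real_cost w x (m, xi) <= real_cost w x (m, eta)].
  have [Qm|] := boolP (Q m); last by exists 0.
  have /andP[mM /existsP[j mjP]] := Qm.
  have [eta etaP|xi xi_min] := @prob_face_min R n
    (fun eta => real_cost w x (m, eta)) (fun j => m j \in P) j mjP.
    by apply/dG/nd.
  by exists xi.
move=> u0A u0P.
case: (@arg_minP _ R _ u0.1 Q (fun m => real_cost w x (m, g m))
  (adQ _ u0A u0P)) => m Qm m_min; have [gmP gmz gmin] := gP m Qm.
have mM : m \in M x by case/andP: Qm.
exists (m, g m); split => //.
  move=> v vA vP; rewrite (le_trans (m_min _ (adQ _ vA vP)))//.
  have [_ _ +] := gP _ (adQ _ vA vP); case: v vA vP => vm vx [_ vs] vP; exact.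
move=> j /= gj.
have := @homogeneous_min_derive R n (fun eta => real_cost w x (m, eta)) (g m) j.
rewrite -/(real_cost w x (m, g m)) => /= <- //.
- have dC := derivableP (diff_derivable (v := delta_mx 0 j)
    (differentiable_run_cost Ox (nd _ _ mM gmP))).
  have dL := derive_weighted_sum (fun j => w (m j)) (g m) j.
  rewrite (@derive_val _ _ _ _ _ _ _ (is_deriveD dC dL)).
  by rewrite addrC ltrD2r; exact: run_cost_derive_gt.
- move=> t eta t0; rewrite /real_cost run_costZ// mulrDr mulr_sumr.
  congr (_ + _).
  by apply: eq_bigr => i _; rewrite mxE mulrA.
(* Such an [eta] is a positive multiple of a point of the simplex, so its displacement is
   nonzero. *)
- move=> eta eta0; set s := \sum_i _ => s0; apply: dG.
  rewrite -[eta]scale1r -(mulfV (lt0r_neq0 s0)) -scalerA displacementZ.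
  rewrite scaler_eq0 negb_or gt_eqF//=; apply: nd => //.
  split=> [i|]; first by rewrite mxE mulr_ge0// invr_ge0 ltW.
  by under eq_bigr do rewrite mxE; rewrite -mulr_sumr -/s mulVf// gt_eqF.
(* [g m] vanishes off [P], so a competitor with no larger support lies in the same face. *)
- move=> eta etaP etaz; apply: gmin => // i /gmz; exact: etaz.
Qed.

End CausalCost.

(** * Expected cost of a policy *)

Section ControlledChain.
Context {R : realType} {n : nat} (Omega : set 'rV[R]_n)
  (f : 'rV[R]_n -> 'rV[R]_n -> R) (q : 'rV[R]_n -> R) (X : {fset 'rV[R]_n})
  (M : X -> {set {ffun 'I_n -> X}}).
Hypothesis q_ge0 : forall x : X, ~ Omega (val x) -> 0 <= q (val x).
Hypothesis run_cost_ge : forall x : X, Omega (val x) ->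
  exists2 c, 0 < c & forall u, admissible M x u -> c <= run_cost f x u.

(** The transition operator of the chain acting on functions, written without its matrix. *)
Definition next_mean (mu : X -> control X) (g : option X -> R) (r : option X)
    : R :=
  if r is Some x then
    if val x \in Omega then \sum_j (mu x).2 0 j * g (Some ((mu x).1 j))
    else g None
  else g None.

Lemma transition_mean mu g r :
  \sum_s transition Omega mu r s * g s = next_mean mu g r.
Proof.
have target : \sum_(s : option X) (s == None)%:R * g s = g None.
  rewrite (bigD1 None)//= mul1r big1 ?addr0// => s /negbTE ->.
  by rewrite mul0r.
case: r => [x|] //=; case: ifP => // _.
transitivity (\sum_s \sum_(j | Some ((mu x).1 j) == s) (mu x).2 0 j * g s).
  apply: eq_bigr => -[y|_]; first by rewrite mulr_suml.
  by rewrite mul0r big_pred0.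
rewrite (exchange_big_dep predT)//=; apply: eq_bigr => j _.
by rewrite (big_pred1 (Some ((mu x).1 j)))// => s /=; rewrite eq_sym.
Qed.

Variables (pi : policy X) (x0 : X).
Hypothesis piA : admissible_policy Omega M pi.

Definition mean (k : nat) (g : option X -> R) : R :=
  \sum_s state_dist Omega pi x0 k s * g s.

Lemma mean0 g : mean 0 g = g (Some x0).
Proof.
rewrite /mean (bigD1 (Some x0))//= eqxx mul1r big1 ?addr0// => s /negbTE ->.
by rewrite mul0r.
Qed.

(** Moves the last transition from the distribution to the test function, so inductions on [k] only
    involve [next_mean]. *)
Lemma meanS k g : mean k.+1 g = mean k (next_mean (pi k) g).
Proof.
rewrite /mean /=; under eq_bigr do rewrite mulr_suml.
rewrite exchange_big /=; apply: eq_bigr => r _.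
by rewrite -transition_mean mulr_sumr; apply: eq_bigr => s _; rewrite mulrA.
Qed.

Lemma next_mean_ge0 k g : (forall s, 0 <= g s) ->
  forall r, 0 <= next_mean (pi k) g r.
Proof.
move=> g0 [x|] //=; case: ifPn => //; rewrite inE => Ox.
by apply: sumr_ge0 => j _; rewrite mulr_ge0//; have [_ []] := piA k Ox.
Qed.

Lemma mean_ge0 k g : (forall s, 0 <= g s) -> 0 <= mean k g.
Proof.
elim: k g => [|k IH] g g0; first by rewrite mean0.
by rewrite meanS; apply: IH; exact: next_mean_ge0.
Qed.

Lemma state_dist_ge0 k s : 0 <= state_dist Omega pi x0 k s.
Proof.
(* The mean of the indicator of [s] is the probability of [s]. *)
have := @mean_ge0 k (fun r => (r == s)%:R) (fun r => ler0n _ _).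
rewrite /mean (bigD1 s)//= eqxx mulr1 big1 ?addr0// => r /negbTE ->.
by rewrite mulr0.
Qed.

Lemma transition_ge0 k r s : 0 <= transition Omega (pi k) r s.
Proof.
have := next_mean_ge0 k (fun t => ler0n R (t == s)) r.
rewrite -transition_mean (bigD1 s)//= eqxx mulr1 big1 ?addr0// => t /negbTE ->.
by rewrite mulr0.
Qed.

Lemma ler_mean k g h :
  (forall s, state_dist Omega pi x0 k s != 0 -> g s <= h s) ->
  mean k g <= mean k h.
Proof.
move=> gh; apply: ler_sum => s _.
have [->|ps] := eqVneq (state_dist Omega pi x0 k s) 0; first by rewrite !mul0r.
by rewrite ler_wpM2l ?state_dist_ge0// gh.
Qed.

Lemma meanD k g h : mean k (fun s => g s + h s) = mean k g + mean k h.
Proof. by rewrite -big_split; apply: eq_bigr => s _; rewrite mulrDr. Qed.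

Lemma meanZ k c g : mean k (fun s => c * g s) = c * mean k g.
Proof. by rewrite /mean mulr_sumr; apply: eq_bigr => s _; rewrite mulrCA. Qed.

Definition stage_mean (k : nat) : R := mean k (stage_cost Omega f q (pi k)).

Lemma stage_cost_ge0 k s : 0 <= stage_cost Omega f q (pi k) s.
Proof.
case: s => [x|] //=; case: ifPn; rewrite ?inE => Ox; last first.
  by apply: q_ge0; move: Ox; rewrite notin_setE.
have [c c0 cP] := run_cost_ge Ox.
by rewrite (le_trans (ltW c0))// cP//; exact: piA.
Qed.

Lemma stage_mean_ge0 k : 0 <= stage_mean k.
Proof. by apply: mean_ge0; exact: stage_cost_ge0. Qed.

Lemma expected_costE :
  expected_cost Omega f q pi x0 = (\sum_(0 <= k <oo) (stage_mean k)%:E)%E.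
Proof. by []. Qed.

(** Supermartingale argument: the cost paid in the first [K] stages plus the mean of [phi] at time
    [K] never exceeds its initial value, and the nonnegative second term may be dropped. The
    inequality is required only at states reached with positive probability. *)
Lemma expected_cost_le (phi : option X -> R) :
  (forall s, 0 <= phi s) ->
  (forall k s, state_dist Omega pi x0 k s != 0 ->
     stage_cost Omega f q (pi k) s + next_mean (pi k) phi s <= phi s) ->
  (expected_cost Omega f q pi x0 <= (phi (Some x0))%:E)%E.
Proof.
move=> phi0 phi_super; rewrite expected_costE; apply: lime_le.
  by apply: is_cvg_nneseries => k _ _; rewrite lee_fin stage_mean_ge0.
apply: nearW => K; rewrite sumEFin lee_fin.
suff : \sum_(0 <= k < K) stage_mean k + mean K phi <= phi (Some x0).
  by apply: le_trans; rewrite lerDl mean_ge0.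
elim: K => [|K IH]; first by rewrite big_nil add0r mean0.
apply: le_trans IH; rewrite big_nat_recr//= -addrA lerD2l meanS -meanD.
by apply: ler_mean => s ps; exact: phi_super.
Qed.

(** From [P] the controls lead only to [P] or to the target. This keeps a policy optimal on accepted
    nodes away from infinite labels. *)
Lemma state_dist_closed (P : {set X}) :
  (forall k x, x \in P -> Omega (val x) -> zero_weight_outside P (pi k x)) ->
  x0 \in P -> forall k x, state_dist Omega pi x0 k (Some x) != 0 -> x \in P.
Proof.
move=> closedP Px0; elim=> [|k IH] x /=.
  by case: (Some x =P Some x0) => [[->]//|_]; rewrite eqxx.
apply: contraNT => xP; apply/eqP; rewrite big1// => -[y|_]; last by rewrite mulr0.
have [->|/IH yP] := eqVneq (state_dist Omega pi x0 k (Some y)) 0.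
  by rewrite mul0r.
rewrite /=; case: ifPn; rewrite ?inE => Oy; last by rewrite mulr0.
rewrite big1 ?mulr0// => j /eqP jx.
by apply: closedP => //; rewrite jx.
Qed.

(** * Subsolutions bound the cost of every policy from below *)

Section LowerBound.
Variable W : X -> \bar R.
Hypothesis W_ge0 : forall x, (0 <= W x)%E.
Hypothesis W_boundary : forall x, ~ Omega (val x) -> (W x <= (q (val x))%:E)%E.
Hypothesis W_sub : forall x u, Omega (val x) -> admissible M x u ->
  (W x <= one_step_cost f W x u)%E.

(** The label is split into an indicator of infinity and a real part ([fine] is 0 at infinity), so
    that all means stay real; both vanish at the target. *)
Let infinite (s : option X) : R := if s is Some x then (W x == +oo%E)%:R else 0.
Let finite_part (s : option X) : R := if s is Some x then fine (W x) else 0.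

Lemma infinite_ge0 s : 0 <= infinite s.
Proof. by case: s => [x|//]; rewrite ler0n. Qed.

Lemma finite_part_ge0 s : 0 <= finite_part s.
Proof. by case: s => [x|//]; exact: fine_ge0. Qed.

Lemma infinite_interior x : W x = +oo%E -> Omega (val x).
Proof. by move=> Wx; apply/not_notP => /W_boundary; rewrite Wx. Qed.

(* Deterministic motion to any vertex of a mode is an admissible control. *)
Lemma infinite_vertex x u j : W x = +oo%E -> admissible M x u ->
  W (u.1 j) = +oo%E.
Proof.
move=> Wx [uM _].
have vA : admissible M x (u.1, delta_mx 0 j).
  by split => //; exact: prob_simplex_delta.
have := W_sub (infinite_interior Wx) vA; rewrite Wx leye_eq /one_step_cost /=.
rewrite (bigD1 j)//= mxE !eqxx /= mul1e big1 => [|i ij]; last first.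
  by rewrite mxE (negbTE ij) andbF mul0e.
by rewrite adde0; case: (W (u.1 j)) (W_ge0 (u.1 j)).
Qed.

(** In Omega each stage costs at least a positive constant, and on the boundary the label is at most
    the penalty paid. Thus vanishing stage costs force the mean labels to vanish. *)
Lemma cost_domination : exists2 kappa, 0 <= kappa &
  forall k s, infinite s + finite_part s <=
    kappa * stage_cost Omega f q (pi k) s.
Proof.
have /choice[kappa kappaP] (x : X) : exists kappa, 0 <= kappa /\
    forall k, infinite (Some x) + finite_part (Some x) <=
      kappa * stage_cost Omega f q (pi k) (Some x).
  have [Ox|Ox] := pselect (Omega (val x)).
    have [c c0 cP] := run_cost_ge Ox.
    exists ((infinite (Some x) + finite_part (Some x)) / c).
    have nn : 0 <= infinite (Some x) + finite_part (Some x).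
      by rewrite addr_ge0 ?infinite_ge0 ?finite_part_ge0.
    split=> [|k]; first by rewrite divr_ge0// ltW.
    rewrite /stage_cost mem_set// mulrAC ler_pdivlMr//.
      by rewrite ler_wpM2l// cP//; exact: piA.
  exists 1; split => // k; rewrite /stage_cost memNset// mul1r.
  have := W_boundary Ox; rewrite /infinite /finite_part.
  by case: (W x) (W_ge0 x) => [r| |] //= _; rewrite lee_fin add0r.
(* As there are finitely many nodes, the sum of the nonnegative local constants is a common one. *)
exists (\sum_x kappa x) => [|k [x|]].
  by apply: sumr_ge0 => x _; case: (kappaP x).
  apply: (le_trans ((kappaP x).2 k)); rewrite ler_wpM2r ?stage_cost_ge0//.
  by rewrite (bigD1 x)//= lerDl; apply: sumr_ge0 => y _; case: (kappaP y).
by rewrite /= add0r mulr0.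
Qed.

(** If the cost is finite, the stage means tend to 0, hence so do the probability of an infinite
    label and the mean finite label. The former is nondecreasing in time, so it is always 0; the
    subsolution inequality then telescopes. *)
Lemma le_expected_cost : (W x0 <= expected_cost Omega f q pi x0)%E.
Proof.
have [|fin] := eqVneq (expected_cost Omega f q pi x0) +oo%E.
  by move=> ->; rewrite leey.
have cost0 : (0 <= expected_cost Omega f q pi x0)%E.
  rewrite expected_costE; apply: nneseries_ge0 => k _ _.
  by rewrite lee_fin stage_mean_ge0.
have [S costS] : exists S, expected_cost Omega f q pi x0 = S%:E.
  by case: (expected_cost _ _ _ _ _) fin cost0 => // S; exists S.
have sumS K : \sum_(0 <= k < K) stage_mean k <= S.
  rewrite -lee_fin -costS expected_costE -sumEFin.
  by apply: nneseries_lim_ge => k _ _; rewrite lee_fin stage_mean_ge0.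
have stage_cvg : stage_mean @ \oo --> (0 : R).
  apply: cvg_series_cvg_0; apply: nondecreasing_is_cvgn.
    apply/nondecreasing_seqP => K; rewrite /series /= big_nat_recr//=.
    by rewrite lerDl stage_mean_ge0.
  by exists S => _ [K _ <-]; exact: sumS.
have [kappa kappa0 kappaP] := cost_domination.
have dom K : mean K infinite + mean K finite_part <= kappa * stage_mean K.
  by rewrite -meanD -meanZ; apply: ler_mean => s _; exact: kappaP.
have small e K0 : 0 < e -> exists2 K, (K0 <= K)%N & kappa * stage_mean K < e.
  (* Adding 1 keeps the denominator positive when [kappa] is 0. *)
  move=> e0; have d0 : 0 < e / (kappa + 1) by rewrite divr_gt0// ltr_wpDl.
  have /cvgrPdist_lt/(_ _ d0)[K1 _ K1P] := stage_cvg.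
  exists (maxn K0 K1); first exact: leq_maxl.
  have := K1P (maxn K0 K1) (leq_maxr _ _).
  rewrite sub0r normrN ger0_norm ?stage_mean_ge0// ltr_pdivlMr ?ltr_wpDl//.
  have := stage_mean_ge0 (maxn K0 K1); nra.
(* Every successor of a node with infinite label again has infinite label, so this mass cannot
   escape. *)
have inf_step k : mean k infinite <= mean k.+1 infinite.
  rewrite meanS; apply: ler_mean => -[x|] _ //=.
  case: eqP => [Wx|_] /=; last first.
    exact: (next_mean_ge0 k infinite_ge0 (Some x)).
  rewrite mem_set; last exact: infinite_interior.
  have uA := piA k (infinite_interior Wx).
  have [_ [_ u1]] := uA; rewrite (eq_bigr (fun j => (pi k x).2 0 j)) ?u1// => j _.
  by rewrite (infinite_vertex _ Wx uA) eqxx mulr1.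
have inf_mono : nondecreasing_seq (fun k => mean k infinite).
  by apply/nondecreasing_seqP; exact: inf_step.
have inf0 k : mean k infinite = 0.
  apply/eqP; rewrite eq_le (mean_ge0 _ infinite_ge0) andbT leNgt.
  apply/negP => /(small _ k)[K kK]; apply/negP; rewrite -leNgt.
  apply: (le_trans _ (dom K)).
  rewrite -[leLHS]addr0 lerD ?(mean_ge0 _ finite_part_ge0)//.
  exact: inf_mono.
have fin_state k x : state_dist Omega pi x0 k (Some x) != 0 -> W x != +oo%E.
  apply: contraNneq => Wx; have := inf0 k; rewrite /mean => /eqP.
  rewrite psumr_eq0 => [|s _]; last first.
    by rewrite mulr_ge0 ?state_dist_ge0 ?infinite_ge0.
  move=> /allP/(_ (Some x)); rewrite mem_index_enum => /(_ isT).
  by rewrite /= Wx eqxx mulr1.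
have finE k x : state_dist Omega pi x0 k (Some x) != 0 -> W x = (fine (W x))%:E.
  by move=> /fin_state; case: (W x) (W_ge0 x).
have step k : mean k finite_part <= stage_mean k + mean k.+1 finite_part.
  rewrite meanS -meanD; apply: ler_mean => -[x|] px; last by rewrite /= addr0.
  rewrite /=; case: ifPn; rewrite ?inE ?notin_setE => Ox; last first.
    by have := W_boundary Ox; rewrite (finE k x px) lee_fin addr0.
  have uA := piA k Ox; have := W_sub Ox uA.
  rewrite (finE k x px) /one_step_cost.
  rewrite (eq_bigr (fun j => ((pi k x).2 0 j * fine (W ((pi k x).1 j)))%:E)).
    by rewrite sumEFin -EFinD lee_fin.
  (* A vertex of weight 0 contributes 0 whatever its label; one of positive weight is reached at
     time [k.+1], so its label is finite. *)
  move=> j _; have [->|uj] := eqVneq ((pi k x).2 0 j) 0.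
    by rewrite mul0e mul0r.
  rewrite EFinM -(finE k.+1)//.
  rewrite gt_eqF//= (bigD1 (Some x))//= mem_set// ltr_pwDl//.
    rewrite mulr_gt0//; first by rewrite lt0r px state_dist_ge0.
    rewrite (bigD1 j)//= ltr_pwDl//.
      by rewrite lt0r uj /=; have [_ []] := uA.
    by apply: sumr_ge0 => i _; have [_ []] := uA.
  apply: sumr_ge0 => r _; rewrite mulr_ge0 ?state_dist_ge0//.
  exact: transition_ge0.
have telescope K : finite_part (Some x0) <= \sum_(0 <= k < K) stage_mean k
    + mean K finite_part.
  elim: K => [|K IH]; first by rewrite big_nil add0r mean0.
  apply: (le_trans IH); rewrite big_nat_recr//= -addrA lerD2l; exact: step.
rewrite costS (finE 0%N x0) /= ?eqxx ?oner_eq0// lee_fin.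
apply/ler_addgt0Pr => e e0; have [K _ Ke] := small e 0%N e0.
apply: (le_trans (telescope K)); rewrite lerD ?sumS//.
rewrite (le_trans _ (ltW Ke))// (le_trans _ (dom K))// lerDr.
exact: mean_ge0 infinite_ge0.
Qed.

End LowerBound.
End ControlledChain.

(** * Label-setting methods *)

Section LabelSetting.
Context {R : realType} {n : nat} (Omega : set 'rV[R]_n)
  (f : 'rV[R]_n -> 'rV[R]_n -> R) (q : 'rV[R]_n -> R) (X : {fset 'rV[R]_n})
  (M : X -> {set {ffun 'I_n -> X}}) (delta : R).
Hypothesis hn : (0 < n)%N.
Hypothesis hX : forall x : X, closure Omega (val x).
Hypothesis Oo : open Omega.
Hypothesis hf : speed_function Omega f.
Hypothesis hq : boundary_penalty Omega q.
Hypothesis hM : stencils Omega M.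
Hypothesis hdelta : 0 <= delta.
Hypothesis hcausal : causal Omega f M delta.

Implicit Types (s : state X) (x y z : X) (u : control X) (P : {set X})
  (lab : X -> \bar R).

Lemma penalty_ge0 x : ~ Omega (val x) -> 0 <= q (val x).
Proof.
move=> Ox; apply: hq.1; split; first exact: hX.
by rewrite (interior_id _).1.
Qed.

Lemma admissible_exists x : Omega (val x) -> exists u, admissible M x u.
Proof.
move=> Ox; have [[m mM] _] := hM Ox.
exists (m, delta_mx 0 (Ordinal hn)); split => //; exact: prob_simplex_delta.
Qed.

(** With zero labels and every node allowed, [optimal_control] says that the running cost attains
    its minimum, which is positive. *)
Lemma run_cost_bound x : Omega (val x) ->
  exists2 c, 0 < c & forall u, admissible M x u -> c <= run_cost f x u.
Proof.
move=> Ox; have [u0 u0A] := admissible_exists Ox.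
have zT u : zero_weight_outside [set: X]%SET u by move=> j; rewrite inE.
have [u [uA _ u_min _]] :=
  optimal_control hf hM hcausal (fun=> 0) Ox u0A (zT u0).
have costE v : real_cost f (fun=> 0) x v = run_cost f x v.
  by rewrite /real_cost big1 ?addr0// => j _; rewrite mulr0.
exists (run_cost f x u) => [|v vA].
  case: u uA {u_min} => m xi [/= mM xiP]; apply: (run_cost_gt0 hf) => //.
  by apply: displacement_neq0 => //; exact: (hM Ox).2.
by rewrite -!costE; exact: u_min.
Qed.

Lemma one_step_cost_fin lab P x u : (forall y, y \in P -> lab y \is a fin_num) ->
  zero_weight_outside P u ->
  one_step_cost f lab x u = (real_cost f (fine \o lab) x u)%:E.
Proof.
move=> labP uP; rewrite /one_step_cost EFinD -sumEFin; congr (_ + _)%E.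
apply: eq_bigr => j _; have [jP|jP] := boolP (u.1 j \in P).
  by rewrite EFinM /= fineK// labP.
by rewrite uP// mul0e mul0r.
Qed.

Lemma eq_one_step_cost lab lab' P x u : {in P, lab =1 lab'} ->
  zero_weight_outside P u ->
  one_step_cost f lab x u = one_step_cost f lab' x u.
Proof.
move=> eqlab uP; congr (_ + _)%E; apply: eq_bigr => j _.
have [jP|jP] := boolP (u.1 j \in P); first by rewrite eqlab.
by rewrite uP// !mul0e.
Qed.

(** The Bellman system restricted to controls supported on the permanent list. [label_sub] also
    covers permanent nodes: nodes accepted later must not offer them anything better. *)
Record label_invariant (s : state X) : Prop := LabelInvariant {
  label_ge0 : forall x, (0 <= label s x)%E;
  label_fin : forall x, x \in permanent s -> label s x \is a fin_num;
  label_boundary : forall x, ~ Omega (val x) -> label s x = (q (val x))%:E;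
  label_sub : forall x u, Omega (val x) -> admissible M x u ->
    zero_weight_outside (permanent s) u ->
    (label s x <= one_step_cost f (label s) x u)%E;
  label_super : forall x, Omega (val x) -> label s x != +oo%E ->
    exists u, [/\ admissible M x u, zero_weight_outside (permanent s) u &
      (one_step_cost f (label s) x u <= label s x)%E] }.

Lemma label_invariant_initial : label_invariant (initial_state Omega q X).
Proof.
split => /= [x|x|x Ox|x u Ox [_ [_ u1]] u0|x Ox].
- by case: ifPn; rewrite ?leey// notin_setE lee_fin => /penalty_ge0.
- by rewrite inE.
- by rewrite memNset.
(* With an empty permanent list no probability vector qualifies, since its weights would sum to
   0. *)
- have := u1; rewrite big1 => [/esym/eqP|j _]; first by rewrite oner_eq0.
  by apply: u0; rewrite inE.
- by rewrite mem_set// eqxx.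
Qed.

(** * One stage: accepting a batch of nodes and relabelling *)

Section Batch.
Variables (s : state X) (P' : {set X}) (A : set (control X)).
Hypothesis s_inv : label_invariant s.
Hypothesis P'_sup : (permanent s \subset P')%SET.
Hypothesis P'_fin : forall x, x \in P' -> label s x \is a fin_num.
Hypothesis A_sub : A `<=` zero_weight_outside P'.
(** Controls supported on the old permanent list may be left out of [A], because [label_sub] already
    compares the label with them. *)
Hypothesis A_sup : forall x u, admissible M x u -> zero_weight_outside P' u ->
  ~ zero_weight_outside (permanent s) u -> A u.
Hypothesis gap : forall x z, x \in P' -> z \in P' -> z \notin permanent s ->
  (label s x <= label s z + delta%:E)%E.

Let s' := State P' (relabel Omega f M P' A (label s)).

Lemma relabel_le x : (label s' x <= label s x)%E.
Proof. by rewrite /= /relabel; case: ifP => // _; rewrite ge_min lexx. Qed.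

Lemma relabel_permanent x : x \in P' -> label s' x = label s x.
Proof. by move=> xP; rewrite /= /relabel xP. Qed.

(** An optimal control over [P'] either uses old permanent nodes only, where [label_sub] applies, or
    puts weight on a new node, whose label lies below the cost by more than [delta]. *)
Lemma batch_optimal x u0 : Omega (val x) -> admissible M x u0 ->
  zero_weight_outside P' u0 ->
  exists u, [/\ admissible M x u, zero_weight_outside P' u,
    forall v, admissible M x v -> zero_weight_outside P' v ->
      (one_step_cost f (label s) x u <= one_step_cost f (label s) x v)%E &
    (label s x <= one_step_cost f (label s) x u)%E \/
    ~ zero_weight_outside (permanent s) u /\
    exists z, [/\ z \in P', z \notin permanent s &
      (label s z + delta%:E < one_step_cost f (label s) x u)%E]].
Proof.
move=> Ox u0A u0P.
have [u [uA uP u_min u_low]] :=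
  optimal_control hf hM hcausal (fine \o label s) Ox u0A u0P.
exists u; split => // [v vA vP|].
  by rewrite !(one_step_cost_fin _ P'_fin)// lee_fin u_min.
have [uP0|uP0] := pselect (zero_weight_outside (permanent s) u).
  by left; exact: label_sub.
right; split => //; have /existsNP[j /not_implyP[jP /eqP uj]] := uP0.
have jP' : u.1 j \in P' by apply: contraT => /uP ujz; rewrite ujz eqxx in uj.
exists (u.1 j); split => //.
rewrite (one_step_cost_fin _ P'_fin)// -(fineK (P'_fin jP')) -EFinD lte_fin.
by apply: u_low; rewrite lt0r uj /=; have [_ []] := uA.
Qed.

Lemma relabel_cases x : label s' x = label s x \/
  Omega (val x) /\ exists2 u, admissible M x u /\ zero_weight_outside P' u &
    (one_step_cost f (label s) x u <= label s' x)%E /\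
    ((label s x <= label s' x)%E \/
     exists z, [/\ z \in P', z \notin permanent s &
      (label s z + delta%:E < label s' x)%E]).
Proof.
rewrite /= /relabel; case: ifPn => [/andP[xP]|_]; last by left.
rewrite inE => Ox; set C := [set _ | _ in _].
rewrite /Order.min; case: ltP => [_|le_inf]; first by left.
(* With no candidate control the infimum is infinite, so the label does not change. *)
have [C0|/set0P[_ [u0 [u0A /A_sub u0P] _]]] := eqVneq C set0.
  by left; apply/eqP; rewrite eq_le le_inf C0 ereal_inf0 leey.
have [u [uA uP u_min u_low]] := batch_optimal Ox u0A u0P.
right; split => //; exists u => //.
have u_inf : (one_step_cost f (label s) x u <= ereal_inf C)%E.
  by apply: le_ereal_inf_tmp => _ [v [vA /A_sub vP] <-]; exact: u_min.
split => //; case: u_low => [lx|[_ [z [zP zP' lz]]]].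
  by left; exact: le_trans lx u_inf.
by right; exists z; split => //; exact: lt_le_trans lz u_inf.
Qed.

(** The delicate clause is [label_sub] at an accepted node: a new node [z] used by an optimal
    control satisfies label of [z] plus [delta] below the cost, while [gap] puts the accepted label
    at or below the former. Accepted labels are therefore final. *)
Lemma batch_invariant : label_invariant s'.
Proof.
(* Labels on [P'] are frozen, so costs of controls supported there are unchanged. *)
have costE x u : zero_weight_outside P' u ->
    one_step_cost f (label s') x u = one_step_cost f (label s) x u.
  by apply: eq_one_step_cost => y; exact: relabel_permanent.
have cost_ge0 x u : Omega (val x) -> admissible M x u ->
    (0 <= one_step_cost f (label s) x u)%E.
  move=> Ox uA; have [c c0 cP] := run_cost_bound Ox.
  rewrite /one_step_cost adde_ge0 ?lee_fin ?(le_trans (ltW c0))// ?cP//.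
  apply: sume_ge0 => j _; rewrite mule_ge0 ?lee_fin ?(label_ge0 s_inv)//.
  by have [_ []] := uA.
split=> [x|x xP|x Ox|x u Ox uA uP|x Ox lx].
- have [->|[Ox [u [uA _] [uc _]]]] := relabel_cases x.
    exact: label_ge0.
  by apply: le_trans uc; exact: cost_ge0.
- by rewrite relabel_permanent// P'_fin.
- by rewrite /= /relabel memNset// andbF; exact: label_boundary.
- rewrite costE//.
  have [v [vA vP v_min v_low]] := batch_optimal Ox uA uP.
  apply: le_trans (v_min _ uA uP).
  have [|[vP0 [z [zP zP' lz]]]] := v_low; first exact/le_trans/relabel_le.
  have [xP|xP] := boolP (x \in P').
    by rewrite relabel_permanent// (le_trans _ (ltW lz))// gap.
  rewrite /= /relabel xP mem_set//= ge_min; apply/orP; right.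
  apply: ereal_inf_lbound; exists v => //; split => //.
  exact: (A_sup vA vP vP0).
- have [eqx|[_ [u [uA uP] [uc _]]]] := relabel_cases x; last first.
    by exists u; split => //; rewrite costE.
  have [|u [uA uP uc]] := label_super s_inv Ox; first by rewrite -eqx.
  have uP' : zero_weight_outside P' u.
    by move=> j jP; apply: uP; apply: contraNN jP; exact: (fintype.subsetP P'_sup).
  by exists u; split; rewrite // eqx costE.
Qed.

(** Used to show that relabelling cannot push a tentative label below the accepted ones. *)
Lemma relabel_ge x : (label s x <= label s' x)%E \/
  exists z, [/\ z \in P', z \notin permanent s &
    (label s z + delta%:E < label s' x)%E].
Proof. by have [->|[_ [u _ [_ ?]]]] := relabel_cases x; [left|]. Qed.

End Batch.

(** The invariant makes the labels a subsolution for [le_expected_cost], and a stationary policy of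
    optimal controls attains them by [expected_cost_le]. *)
Lemma stopped_label s : label_invariant s -> stopped s ->
  forall x, label s x = value Omega f q M x.
Proof.
move=> s_inv s_stop x0.
have finP x : label s x != +oo%E -> x \in permanent s.
  by apply: contraNT => /s_stop ->.
apply/eqP; rewrite eq_le; apply/andP; split.
  apply: le_ereal_inf_tmp => _ [pi piA <-].
  apply: (le_expected_cost penalty_ge0 run_cost_bound x0 piA) => [x|x Ox|x u Ox uA].
  - exact: label_ge0.
  - by rewrite label_boundary.
  have [uP|/existsNP[j /not_implyP[jP /eqP uj]]] :=
    pselect (zero_weight_outside (permanent s) u); first exact: label_sub.
  (* Positive weight on a tentative node, whose label is infinite at stopping, makes the cost
     infinite. *)
  have uj0 : 0 < u.2 0 j by rewrite lt0r uj /=; have [_ []] := uA.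
  rewrite /one_step_cost (bigD1 j)//= (s_stop _ jP) gt0_muley ?lte_fin//.
  rewrite addye ?addey ?leey// gt_eqF// (lt_le_trans ltNy0)//.
  apply: sume_ge0 => i _; rewrite mule_ge0 ?lee_fin ?(label_ge0 s_inv)//.
  by have [_ []] := uA.
have [->|lx0] := eqVneq (label s x0) +oo%E; first exact: leey.
have /choice[mu muP] x : exists u, Omega (val x) -> admissible M x u /\
    (label s x != +oo%E -> zero_weight_outside (permanent s) u /\
      (one_step_cost f (label s) x u <= label s x)%E).
  (* Outside Omega the control is a dummy that the chain never uses. *)
  have [Ox|Ox] := pselect (Omega (val x)); last by exists ([ffun=> x], 0).
  have [lx|lx] := eqVneq (label s x) +oo%E.
    by have [u uA] := admissible_exists Ox; exists u.
  by have [u [uA uP uc]] := label_super s_inv Ox lx; exists u.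
pose pi : policy X := fun=> mu.
have piA : admissible_policy Omega M pi by move=> k x /muP[].
have Pfin x : x \in permanent s -> label s x != +oo%E.
  by move/(label_fin s_inv); rewrite fin_numE => /andP[].
apply: (@le_trans _ _ (expected_cost Omega f q pi x0)).
  by apply: ereal_inf_lbound; exists pi.
pose phi (t : option X) : R := if t is Some x then fine (label s x) else 0.
rewrite -[leRHS]fineK ?(label_fin s_inv) ?finP//.
apply: (expected_cost_le penalty_ge0 run_cost_bound piA (phi := phi)).
  by case=> [x|//]; rewrite fine_ge0// (label_ge0 s_inv).
move=> k [x|] px; last by rewrite /= addr0.
have xP : x \in permanent s.
  apply: (state_dist_closed _ (finP _ lx0) px) => i y yP Oy.
  by have [_ /(_ (Pfin _ yP))[]] := muP y Oy.
rewrite /=; case: ifPn; rewrite ?inE ?notin_setE => Ox; last first.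
  by rewrite (label_boundary s_inv Ox) addr0.
have [uA /(_ (Pfin _ xP))[uP]] := muP x Ox.
rewrite (one_step_cost_fin _ (label_fin s_inv))//.
by rewrite -[in leRHS](fineK (label_fin s_inv xP)) lee_fin.
Qed.

(** Each stage strictly enlarges the permanent list, so the number of tentative nodes is a
    termination measure. *)
Lemma terminates_with_increasing (step : state X -> state X -> Prop)
    (Q : (X -> \bar R) -> Prop) (I : state X -> Prop) :
  (forall s, I s -> stopped s -> Q (label s)) ->
  (forall s, I s -> ~ stopped s -> exists s', step s s') ->
  (forall s s', I s -> ~ stopped s -> step s s' ->
     I s' /\ (permanent s \proper permanent s')%SET) ->
  forall s, I s -> terminates_with step Q s.
Proof.
move=> stopQ prog pres s.
have [N] := ubnP #|~: permanent s|%SET; elim: N s => // N IH s sN Is.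
have [st|st] := pselect (stopped s); first by apply: TerminatesNow; auto.
apply: TerminatesLater => //; first exact: prog.
move=> s' ss'; have [Is' sub] := pres _ _ Is st ss'.
apply: IH => //; rewrite -ltnS; apply: leq_trans sN; rewrite ltnS.
by apply: proper_card; rewrite properC.
Qed.

Lemma not_stopped s : ~ stopped s ->
  exists2 x, x \notin permanent s & label s x != +oo%E.
Proof. by move=> /existsNP[x /not_implyP[xP /eqP lx]]; exists x. Qed.

Lemma dijkstra_applicable : applicable Omega f q M (dijkstra_step Omega f M).
Proof.
(* With this ordering the accepted minimum [y] has the largest label of the new permanent list, so
   [gap] holds for any nonnegative [delta]. *)
pose I (s : state X) := label_invariant s /\ forall x y,
  x \in permanent s -> y \notin permanent s -> (label s x <= label s y)%E.
apply: (@terminates_with_increasing _ _ I).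
- by move=> s [s_inv _]; exact: stopped_label.
- move=> s _ /not_stopped[x0 x0P _].
  case: (@Order.TotalTheory.arg_minP _ _ _ x0
    (fun x => x \notin permanent s) (label s) x0P).
  by move=> y yP y_min; eexists; exists y; split.
- move=> s _ [s_inv mono] /not_stopped[x0 x0P lx0] [y [yP y_min ->]].
  have y_fin : label s y \is a fin_num.
    rewrite fin_numElt (lt_le_trans ltNy0) ?(label_ge0 s_inv)//=.
    by apply: (le_lt_trans (y_min _ x0P)); rewrite ltey.
  set P' := (y |: permanent s)%SET.
  have sub : (permanent s \subset P')%SET by exact: finset.subsetUr.
  have P'_le x : x \in P' -> (label s x <= label s y)%E.
    by rewrite !inE => /orP[/eqP ->//|xP]; exact: mono.
  have P'_new z : z \in P' -> z \notin permanent s -> z = y.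
    by rewrite !inE => /orP[/eqP //|->].
  have P'_fin x : x \in P' -> label s x \is a fin_num.
    by rewrite !inE => /orP[/eqP ->//|]; exact: label_fin.
  set A := positive_weight_on y `&` zero_weight_outside P'.
  have A_sub : A `<=` zero_weight_outside P' by move=> u [].
  have A_sup x u : admissible M x u -> zero_weight_outside P' u ->
      ~ zero_weight_outside (permanent s) u -> A u.
    move=> uA uP' /existsNP[j /not_implyP[jP /eqP uj]]; split => //; exists j.
      apply: P'_new => //; apply: contraT => /uP' ujz.
      by rewrite ujz eqxx in uj.
    by rewrite lt0r uj /=; have [_ []] := uA.
  have gap x z : x \in P' -> z \in P' -> z \notin permanent s ->
      (label s x <= label s z + delta%:E)%E.
    move=> xP' zP' /(P'_new _ zP') ->.
    by rewrite (le_trans (P'_le _ xP'))// leeDl// lee_fin.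
  split; last first.
    rewrite properE sub; apply/fintype.subsetPn.
    by exists y; rewrite ?finset.setU11.
  split; first exact: (batch_invariant s_inv sub P'_fin A_sub A_sup gap).
  move=> x z xP' zP'; rewrite relabel_permanent// (le_trans (P'_le _ xP'))//.
  have [|[t [tP' tP lt]]] := relabel_ge s_inv P'_fin A_sub z.
    apply: le_trans; apply: y_min; apply: contraNN zP'; exact: (fintype.subsetP sub).
  rewrite (le_trans _ (ltW lt))// (P'_new _ tP' tP) leeDl// lee_fin//.
- by split; [exact: label_invariant_initial|move=> x y; rewrite inE].
Qed.

Lemma mem_bucket s x : 0 < delta -> (0 <= label s x)%E -> label s x != +oo%E ->
  x \notin permanent s -> exists2 i : nat, x \in bucket delta s i &
    ((i%:R * delta)%:E <= label s x)%E.
Proof.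
move=> d0; rewrite /bucket; case lx: (label s x) => [r| |]//=.
rewrite lee_fin => r0 _ xP.
have /truncn_itv/andP[tr rt] : 0 <= r / delta by rewrite divr_ge0.
(* The bucket index is the integer part of the label divided by the width. *)
exists (Num.truncn (r / delta)); rewrite ?inE ?xP ?lx ?lee_fin ?lte_fin /=.
  by rewrite -ler_pdivlMr// -ltr_pdivrMr// tr.
by rewrite -ler_pdivlMr.
Qed.

Lemma dial_applicable : 0 < delta ->
  applicable Omega f q M (dial_step Omega f M delta).
Proof.
move=> d0.
(* [K * delta] separates permanent labels from tentative ones. *)
pose I (s : state X) := label_invariant s /\ exists K : nat,
  (forall x, x \in permanent s -> (label s x < (K%:R * delta)%:E)%E) /\
  (forall x, x \notin permanent s -> ((K%:R * delta)%:E <= label s x)%E).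
have leM (i j : nat) : ((i%:R * delta)%:E <= (j%:R * delta)%:E)%E = (i <= j)%N.
  by rewrite lee_fin ler_pM2r// ler_nat.
have ltM (i j : nat) : ((i%:R * delta)%:E < (j%:R * delta)%:E)%E = (i < j)%N.
  by rewrite lte_fin ltr_pM2r// ltr_nat.
apply: (@terminates_with_increasing _ _ I).
- by move=> s [s_inv _]; exact: stopped_label.
- move=> s [s_inv _] /not_stopped[x xP lx].
  have [i xi _] := mem_bucket d0 (label_ge0 s_inv x) lx xP.
  have ex : exists i, bucket delta s i != finset.set0.
    by exists i; apply/finset.set0Pn; exists x.
  case: (ex_minnP ex) => k k0 k_min; eexists; exists k; split=> // [|j jk].
    exact/eqP.
  by apply/eqP; apply: contraTT jk => /k_min; rewrite leqNgt.
- move=> s _ [s_inv [K [K_gt K_le]]] /not_stopped[x0 x0P lx0] [k [k0 k_min ->]].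
  set P' := (permanent s :|: bucket delta s k)%SET.
  have bucketP x : x \in bucket delta s k -> x \notin permanent s /\
      ((k%:R * delta)%:E <= label s x < (k.+1%:R * delta)%:E)%E.
    by rewrite inE => /andP[].
  have out_ge x : x \notin permanent s -> ((k%:R * delta)%:E <= label s x)%E.
    move=> xP; have [->|lx] := eqVneq (label s x) +oo%E; first exact: leey.
    have [i xi ix] := mem_bucket d0 (label_ge0 s_inv x) lx xP.
    apply: le_trans ix; rewrite leM leqNgt; apply/negP => /k_min bi.
    by rewrite bi inE in xi.
  have out_ge' x : x \notin P' -> ((k.+1%:R * delta)%:E <= label s x)%E.
    rewrite finset.in_setU negb_or => /andP[xP]; rewrite inE xP /= out_ge//=.
    by rewrite -leNgt.
  (* A node of the chosen bucket has label at least [K * delta] and below [(k + 1) * delta]. *)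
  have Kk : (K <= k)%N.
    have /finset.set0Pn[z /bucketP[zP /andP[_ zk]]] : bucket delta s k != finset.set0.
      exact/eqP.
    by rewrite -ltnS -ltM; apply: le_lt_trans zk; exact: K_le.
  have P'_lt x : x \in P' -> (label s x < (k.+1%:R * delta)%:E)%E.
    rewrite finset.in_setU => /orP[/K_gt xK|/bucketP[_ /andP[]]//].
    by apply: (lt_le_trans xK); rewrite leM leqW.
  have sub : (permanent s \subset P')%SET by exact: finset.subsetUl.
  have P'_fin x : x \in P' -> label s x \is a fin_num.
    move=> /P'_lt xk; rewrite fin_numElt (lt_trans xk (ltey _)) andbT.
    by rewrite (lt_le_trans ltNy0)// label_ge0.
  set A := zero_weight_outside P'.
  have A_sub : A `<=` zero_weight_outside P' by [].
  have A_sup x u : admissible M x u -> zero_weight_outside P' u ->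
      ~ zero_weight_outside (permanent s) u -> A u by [].
  (* The width matches the causality margin: a tentative label plus [delta] is at least the upper
     end of the current bucket, which gives [gap]. *)
  have new_ge z : z \notin permanent s ->
      ((k.+1%:R * delta)%:E <= label s z + delta%:E)%E.
    by move=> zP; rewrite -natr1 mulrDl mul1r EFinD leeD2r// out_ge.
  have gap x z : x \in P' -> z \in P' -> z \notin permanent s ->
      (label s x <= label s z + delta%:E)%E.
    by move=> /P'_lt/ltW xk _ zP; exact: le_trans xk (new_ge _ zP).
  split; last first.
    have /finset.set0Pn[z zk] : bucket delta s k != finset.set0 by exact/eqP.
    rewrite properE sub; apply/fintype.subsetPn; exists z.
      by rewrite finset.in_setU zk orbT.
    by have [] := bucketP z zk.
  split; first exact: (batch_invariant s_inv sub P'_fin A_sub A_sup gap).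
  (* Any lowered label exceeds a label of the batch plus [delta], so no node falls back into bucket
     [k]. *)
  exists k.+1; split=> [x xP'|x xP'].
    by rewrite relabel_permanent// P'_lt.
  have [|[z [_ zP lz]]] := relabel_ge s_inv P'_fin A_sub x.
    by apply: le_trans; exact: out_ge'.
  by apply: (le_trans (new_ge _ zP)); exact: ltW.
- split; first exact: label_invariant_initial.
  exists 0%N; split=> x; first by rewrite inE.
  by rewrite mul0r => _; exact: label_ge0 label_invariant_initial x.
Qed.

End LabelSetting.

Lemma mesh_vertex (R : realType) (n : nat) (D : set 'rV[R]_n)
    (X : {fset 'rV[R]_n}) (T : {set {set X}}) (x : X) :
  simplicial_mesh D T -> D (val x).
Proof.
move=> [_ _ /(_ x)[S ST xS] <-]; exists S => //.
exists (fun v => (v == x)%:R); split => [v|v vS||].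
- exact: ler0n.
- by case: eqP vS => // ->; rewrite xS.
- by rewrite (bigD1 x)//= eqxx big1 ?addr0// => v /negbTE ->.
- rewrite (bigD1 x)//= eqxx scale1r big1 ?addr0// => v /negbTE ->.
  by rewrite scale0r.
Qed.

Theorem mainTheorem6 (R : realType) (n : nat) (Omega : set 'rV[R]_n)
    (f : 'rV[R]_n -> 'rV[R]_n -> R) (q : 'rV[R]_n -> R)
    (X : {fset 'rV[R]_n}) (T : {set {set X}})
    (M : X -> {set {ffun 'I_n -> X}}) (delta : R)
    (hn : (0 < n)%N)
    (hOmega : bounded_domain Omega)
    (hX : simplicial_mesh (closure Omega) T)
    (hf : speed_function Omega f)
    (hq : boundary_penalty Omega q)
    (hM : stencils Omega M)
    (hdelta : 0 <= delta)
    (hcausal : forall (x : X) (m : {ffun 'I_n -> X}) (xi : 'rV[R]_n) (j : 'I_n),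
       Omega (val x) -> m \in M x -> prob_simplex xi -> 0 < xi 0 j ->
       'D_(delta_mx 0 j) (fun eta => f (val x) (direction x m eta)) xi <
       f (val x) (direction x m xi) *
         ('D_(delta_mx 0 j) (tau x m) xi
            - delta * f (val x) (direction x m xi)) / tau x m xi) :
  applicable Omega f q M (dijkstra_step Omega f M) /\
  (0 < delta -> applicable Omega f q M (dial_step Omega f M delta)).
Proof.
have [Oo _ _ _] := hOmega.
have XO x : closure Omega (val x) := mesh_vertex x hX.
split; first exact: (dijkstra_applicable hn XO Oo hf hq hM hdelta hcausal).
exact: (dial_applicable hn XO Oo hf hq hM hdelta hcausal).
Qed.
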